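(* Define the following signed complete graphs (every edge positive unless listed as negative): $K_3^{(1)}$: $K_3$ with all edges positive; $K_3^{(2)}$: $K_3$ with exactly one negative edge. On vertices $a,b,c,d$: $K_4^{(1)}$: all edges positive; $K_4^{(2)}$: only $cd$ negative; $K_4^{(3)}$: $ab$ and $cd$ negative. On vertices $w_1,\dots,w_5$: $K_5^{(1)}$: all positive; $K_5^{(2)}$: $w_3w_4$ negative; $K_5^{(3)}$: $w_3w_4,w_2w_5$ negative; $K_5^{(4)}$: $w_1w_2,w_1w_5$ negative; $K_5^{(5)}$: $w_1w_2,w_1w_5,w_3w_4$ negative; $K_5^{(6)}$: $w_2w_3,w_3w_4,w_4w_5$ negative; $K_5^{(7)}$: $w_1w_2,w_1w_5,w_3w_4,w_2w_5$ negative. Then for every positive integer $k$, \begin{align*} c_{K_3^{(1)}}(2k+1) &= 8k^3 - 2k , & c_{K_3^{(2)}}(2k+1) &= 8k^3 ,\\ c_{K_4^{(1)}}(2k+1) &= 16k^4-16k^3-4k^2+4k , & c_{K_4^{(2)}}(2k+1) &= 16k^4-16k^3+4k^2 ,\\ c_{K_4^{(3)}}(2k+1) &= 16k^4-16k^3+12k^2-2k , &&\\ c_{K_5^{(1)}}(2k+1) &= 32k^5 - 80k^4 + 40k^3 + 20k^2 - 12k , & c_{K_5^{(2)}}(2k+1) &= 32k^5 - 80k^4 + 64k^3 - 16k^2 ,\\ c_{K_5^{(3)}}(2k+1) &= 32k^5 - 80k^4 + 88k^3 - 48k^2 + 10k , & c_{K_5^{(4)}}(2k+1) &= 32k^5 -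 80k^4 + 72k^3 - 28k^2 + 4k ,\\ c_{K_5^{(5)}}(2k+1) &= 32k^5 - 80k^4 + 96k^3 - 56k^2 + 12k , & c_{K_5^{(6)}}(2k+1) &= 32k^5 - 80k^4 + 80k^3 - 40k^2 + 8k ,\\ c_{K_5^{(7)}}(2k+1) &= 32k^5 - 80k^4 + 120k^3 - 80k^2 + 20k . && \end{align*}
   Context: A signed graph $\Sigma=(V,E,\sigma)$ is a graph with a signature $\sigma\in\{+,-\}^E$ assigning a sign $\sigma_{vw}=\pm1$ to each edge $vw$. For a positive integer $k$, the chromatic polynomial value $c_\Sigma(2k+1)$ is the number of colorings $\mathbf{x}\in\{0,\pm1,\dots,\pm k\}^V$ such that $x_v\neq\sigma_{vw}x_w$ for every edge $vw\in E$. (This count is a polynomial in $k$.) *)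

(* Defs.v *)
From HB Require Import structures.
From mathcomp Require Import all_boot all_order all_algebra.

Set Implicit Arguments.
Unset Strict Implicit.
Unset Printing Implicit Defensive.

Import Order.TTheory GRing.Theory Num.Theory.
Local Open Scope ring_scope.

(* [negative v w] is only meaningful when [edge v w] holds. *)
Record signed_graph (V : finType) := SignedGraph {
  edge : rel V;
  negative : rel V;
  edge_sym : symmetric edge;
  edge_irr : irreflexive edge;
  negative_sym : symmetric negative
}.

Definition sigma (V : finType) (S : signed_graph V) (v w : V) : int :=
  if negative S v w then -1 else 1.

(* The 2k+1 colors 0, ±1, ..., ±k are indexed by 'I_(2k+1), shifted by k. *)
Definition color (k : nat) (i : 'I_(2 * k + 1)) : int := i%:Z - k%:Z.

Lemma color_inj (k : nat) : injective (@color k).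
Proof. by move=> i j /addIr [] /val_inj. Qed.

Lemma color_range (k : nat) (z : int) :
  (exists i : 'I_(2 * k + 1), color i = z) <-> - k%:Z <= z <= k%:Z.
Proof.
split=> [[i <-]|/andP[lo hi]].
  rewrite /color lerBrDr addNr lez_nat leq0n lerBlDr -PoszD lez_nat /=.
  by rewrite addnn -mul2n -ltnS -[(2 * k).+1]addn1 ltn_ord.
have: 0 <= z + k%:Z by rewrite -lerBlDr sub0r.
case E: (z + k%:Z) => [m|//] _.
have lt_m : (m < 2 * k + 1)%N.
  by rewrite addn1 ltnS mul2n -addnn -lez_nat PoszD -E lerD2r.
by exists (Ordinal lt_m); rewrite /color /= -E addrK.
Qed.

Definition proper_coloring (V : finType) (S : signed_graph V) (k : nat)
    (x : {ffun V -> 'I_(2 * k + 1)}) : bool :=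
  [forall v, forall w,
     edge S v w ==> (color (x v) != sigma S v w * color (x w))].

(* [chrom S k] is the value of the chromatic polynomial of S at 2k+1. *)
Definition chrom (V : finType) (S : signed_graph V) (k : nat) : nat :=
  #|[set x : {ffun V -> 'I_(2 * k + 1)} | proper_coloring S x]|.

Section SignedComplete.
Variables (n : nat) (N : seq ('I_n * 'I_n)).

Definition complete_edge : rel 'I_n := fun i j => i != j.

Definition listed : rel 'I_n := fun i j => ((i, j) \in N) || ((j, i) \in N).

Lemma complete_edge_sym : symmetric complete_edge.
Proof. by move=> i j; rewrite /complete_edge eq_sym. Qed.

Lemma complete_edge_irr : irreflexive complete_edge.
Proof. by move=> i; rewrite /complete_edge eqxx. Qed.

Lemma listed_sym : symmetric listed.
Proof. by move=> i j; rewrite /listed orbC. Qed.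

(* Each negative edge is listed once, in either orientation. *)
Definition signedK : signed_graph 'I_n :=
  SignedGraph complete_edge_sym complete_edge_irr listed_sym.

End SignedComplete.

Definition K3_1 := signedK (n := 3) [::].
Definition K3_2 (u v : 'I_3) := signedK [:: (u, v)].

Definition va : 'I_4 := @Ordinal 4 0 isT.
Definition vb : 'I_4 := @Ordinal 4 1 isT.
Definition vc : 'I_4 := @Ordinal 4 2 isT.
Definition vd : 'I_4 := @Ordinal 4 3 isT.

Definition K4_1 := signedK (n := 4) [::].
Definition K4_2 := signedK [:: (vc, vd)].
Definition K4_3 := signedK [:: (va, vb); (vc, vd)].

Definition w1 : 'I_5 := @Ordinal 5 0 isT.
Definition w2 : 'I_5 := @Ordinal 5 1 isT.
Definition w3 : 'I_5 := @Ordinal 5 2 isT.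
Definition w4 : 'I_5 := @Ordinal 5 3 isT.
Definition w5 : 'I_5 := @Ordinal 5 4 isT.

Definition K5_1 := signedK (n := 5) [::].
Definition K5_2 := signedK [:: (w3, w4)].
Definition K5_3 := signedK [:: (w3, w4); (w2, w5)].
Definition K5_4 := signedK [:: (w1, w2); (w1, w5)].
Definition K5_5 := signedK [:: (w1, w2); (w1, w5); (w3, w4)].
Definition K5_6 := signedK [:: (w2, w3); (w3, w4); (w4, w5)].
Definition K5_7 := signedK [:: (w1, w2); (w1, w5); (w3, w4); (w2, w5)].

(* Main.v *)
(** A coloring determines a signed pattern: which vertices are colored [0],
    and which vertices carry equal or opposite colors.  Relabel the absolute
    values of the nonzero colors as [1, 2, ...] in order of appearance, with
    each first occurrence taken positive.  Whether a coloring is proper depends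
    only on its pattern, and a pattern with [j] distinct nonzero absolute values
    is realized by exactly [2k * 2(k-1) * ... * 2(k-j+1)] colorings.  So each
    chromatic polynomial is obtained by enumerating finitely many patterns. *)
Require Import Defs.
From mathcomp Require Import all_boot all_order all_algebra.
From mathcomp Require Import ring zify.

Set Implicit Arguments.
Unset Strict Implicit.
Unset Printing Implicit Defensive.

Import Order.TTheory GRing.Theory Num.Theory.
Local Open Scope ring_scope.

(** This list plays two roles: for [m = k] it holds the colors, and otherwise the labels available
    to a pattern that has used [m] nonzero absolute values. The label 0 is always available. *)
Fixpoint codes (m : nat) : seq int :=
  if m is m'.+1 then [:: m'.+1%:Z, - m'.+1%:Z & codes m'] else [:: 0].

Lemma mem_codes m (z : int) : (z \in codes m) = (`|z| <= m)%N.
Proof. by elim: m => [|m IHm]; rewrite /= !inE ?IHm; lia. Qed.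

Lemma memN_codes m (z : int) : (- z \in codes m) = (z \in codes m).
Proof. by rewrite !mem_codes abszN. Qed.

Lemma uniq_codes m : uniq (codes m).
Proof. by elim: m => [|m IHm] //=; rewrite inE !mem_codes IHm; lia. Qed.

Lemma size_codes m : size (codes m) = (2 * m + 1)%N.
Proof. by elim: m => [|m IHm] //=; rewrite IHm; lia. Qed.

Lemma perm_color_codes k :
  perm_eq [seq color i | i <- index_enum 'I_(2 * k + 1)] (codes k).
Proof.
apply: uniq_perm; last 1 first.
- move=> z; rewrite mem_codes; apply/mapP/idP => [[i _ ->]|z_le].
    by rewrite /color; have := ltn_ord i; lia.
  have [|i <-] := (color_range k z).2; first by lia.
  by exists i; rewrite ?mem_index_enum.
- by rewrite map_inj_uniq ?index_enum_uniq //; apply: color_inj.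
- exact: uniq_codes.
Qed.

(** * Counting signed patterns by number of absolute values *)

Fixpoint add_counts (a b : seq nat) : seq nat :=
  match a, b with
  | [::], _ => b
  | _, [::] => a
  | x :: a', y :: b' => (x + y)%N :: add_counts a' b'
  end.

(** Here [p] is the pattern so far, [m] its number of absolute values, and [r] the number of
    vertices left. The next vertex either reuses a label of [codes m] or opens the label [m + 1],
    always with positive sign; the leading zero shifts the counts by the absolute value just
    opened. *)
Fixpoint pattern_counts (Q : pred (seq int)) r (p : seq int) m : seq nat :=
  if r is r'.+1 then
    add_counts
      (foldr add_counts [::]
         [seq pattern_counts Q r' (rcons p z) m | z <- codes m])
      (0%N :: pattern_counts Q r' (rcons p m.+1%:Z) m.+1)
  else [:: nat_of_bool (Q p)].

(* The [j]-th count gets weight [\prod_(m <= i < m + j) 2 (K - i)]. *)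
Fixpoint eval_counts (K : int) m (c : seq nat) : int :=
  if c is x :: c' then x%:Z + 2 * (K - m%:Z) * eval_counts K m.+1 c' else 0.

Lemma eval_add_counts K m a b :
  eval_counts K m (add_counts a b) = eval_counts K m a + eval_counts K m b.
Proof.
elim: a b m => [|x a IHa] [|y b] m //=; rewrite ?add0r ?addr0 // IHa.
by rewrite PoszD; ring.
Qed.

Lemma eval_foldr_add_counts K m (T : Type) (f : T -> seq nat) s :
  eval_counts K m (foldr add_counts [::] [seq f z | z <- s]) =
  \sum_(z <- s) eval_counts K m (f z).
Proof.
elim: s => [|z s IHs]; first by rewrite big_nil.
by rewrite big_cons /= eval_add_counts IHs.
Qed.

(** * From patterns to color sequences *)

Fixpoint extensions k (Q : pred (seq int)) r (s : seq int) : int :=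
  if r is r'.+1 then \sum_(a <- codes k) extensions k Q r' (rcons s a)
  else (Q s)%:Z.

(** Such a map realizes a pattern by actual colors: oddness preserves opposite labels, and
    injectivity keeps distinct labels distinct. *)
Definition odd_embedding (phi : int -> int) m :=
  {morph phi : z / - z} /\ {in codes m &, injective phi}.

Definition relabeling_invariant (Q : pred (seq int)) :=
  forall phi m p, odd_embedding phi m -> {subset p <= codes m} ->
    Q [seq phi z | z <- p] = Q p.

(** Send the new labels [m + 1] and [- (m + 1)] to [a] and [- a]. The old image is closed under
    negation, so it misses [- a] as well as [a]. *)
Lemma odd_embedding_extend phi m k (a : int) :
    odd_embedding phi m -> {subset [seq phi z | z <- codes m] <= codes k} ->
    a \in codes k -> a \notin [seq phi z | z <- codes m] ->
  exists psi, [/\ odd_embedding psi m.+1,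
    {subset [seq psi z | z <- codes m.+1] <= codes k},
    {in codes m, psi =1 phi} & psi m.+1%:Z = a].
Proof.
move=> [phiN phi_inj] phi_sub ak aNphi.
have phi0 : phi 0 = 0 by have := phiN 0; rewrite oppr0; move: (phi 0) => x; lia.
have aphi (z : int) : z \in codes m -> phi z != a.
  by move=> zm; apply: contraNneq aNphi => <-; apply: map_f.
have aphiN (z : int) : z \in codes m -> phi z != - a.
  move=> zm; apply/eqP => phiz; have /eqP[] : phi (- z) != a.
    by rewrite aphi ?memN_codes.
  by rewrite phiN phiz opprK.
(* Hence [a] and [- a] differ, as injectivity on the two new labels demands. *)
have a0 : a != 0 by rewrite eq_sym -phi0 aphi // mem_codes.
pose psi z := if z == m.+1%:Z then a else if z == - m.+1%:Z then - a else phi z.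
have psi_m : {in codes m, psi =1 phi}.
  by move=> z; rewrite mem_codes /psi => zm; rewrite !ifF //; lia.
have psiS : psi m.+1%:Z = a by rewrite /psi eqxx.
have psiNS : psi (- m.+1%:Z) = - a by rewrite /psi eqxx.
exists psi; split=> //; first split.
- move=> z; rewrite /psi.
  have -> : (- z == m.+1%:Z) = (z == - m.+1%:Z) by lia.
  have -> : (- z == - m.+1%:Z) = (z == m.+1%:Z) by lia.
  case: eqP => [->|_]; first by rewrite /= opprK.
  by case: eqP => _; rewrite ?opprK ?phiN.
- move=> y z; rewrite !inE.
  case/or3P => [/eqP->|/eqP->|ym]; case/or3P => [/eqP->|/eqP->|zm] //;
    rewrite ?psiS ?psiNS ?psi_m //; try lia.
  + by move/eqP; rewrite eq_sym (negPf (aphi _ zm)).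
  + by move/eqP; rewrite eq_sym (negPf (aphiN _ zm)).
  + by move/eqP; rewrite (negPf (aphi _ ym)).
  + by move/eqP; rewrite (negPf (aphiN _ ym)).
  + exact: phi_inj.
- rewrite /= psiS psiNS => z; rewrite !inE => /or3P[/eqP->|/eqP->|] //.
    by rewrite memN_codes.
  by have /eq_in_map -> := psi_m; apply: phi_sub.
Qed.

(** Induction on the number of vertices left, splitting the next color by whether it lies in the
    image of [phi]. Colors in the image correspond to reused labels; each other color amounts to
    opening the label [m + 1]. *)
Lemma extensions_pattern_counts k Q r phi p m :
    relabeling_invariant Q -> odd_embedding phi m ->
    {subset [seq phi z | z <- codes m] <= codes k} -> {subset p <= codes m} ->
  extensions k Q r [seq phi z | z <- p] =
  eval_counts k%:Z m (pattern_counts Q r p m).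
Proof.
move=> Qinv; elim: r phi p m => [|r IHr] phi p m phi_emb phi_sub p_sub.
  by rewrite /= (Qinv _ m) // mulr0 addr0.
have phi_uniq : uniq [seq phi z | z <- codes m].
  by rewrite map_inj_in_uniq ?uniq_codes //; case: phi_emb.
pose old := [pred a | a \in [seq phi z | z <- codes m]].
have old_perm : perm_eq [seq a <- codes k | old a] [seq phi z | z <- codes m].
  apply: uniq_perm; rewrite ?filter_uniq ?uniq_codes // => a.
  by rewrite mem_filter /=; apply: andb_idr => /phi_sub.
rewrite [LHS]/= (bigID old) /= -big_filter (perm_big _ old_perm) big_map.
rewrite eval_add_counts eval_foldr_add_counts /= add0r; congr (_ + _).
  apply: eq_big_seq => z zm; rewrite -map_rcons (IHr _ _ m) // => y.
  by rewrite mem_rcons inE => /orP[/eqP->|/p_sub].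
(* Every new color [a] contributes the same amount: extend [phi] to [psi] with [psi (m + 1) = a],
   which leaves the colors of [p] unchanged. *)
rewrite big_seq_cond (eq_bigr (fun=> eval_counts k%:Z m.+1
  (pattern_counts Q r (rcons p m.+1%:Z) m.+1))); last first.
  move=> a /andP[ak aNphi].
  have [psi [psi_emb psi_sub psi_m psiS]] :=
    odd_embedding_extend phi_emb phi_sub ak aNphi.
  rewrite -[in LHS]psiS.
  have -> : [seq phi z | z <- p] = [seq psi z | z <- p].
    by apply/eq_in_map => z /p_sub /psi_m.
  rewrite -map_rcons (IHr _ _ m.+1) // => z; rewrite mem_rcons !inE.
  by move=> /predU1P[->|/p_sub ->]; rewrite ?eqxx ?orbT.
rewrite -big_seq_cond big_const_seq iter_addr_0 -[LHS]mulr_natl; congr (_ * _).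
(* The number of new colors is [(2k + 1) - (2m + 1) = 2(k - m)], the weight in [eval_counts]. *)
have := count_predC old (codes k).
rewrite -size_filter (perm_size old_perm) size_map !size_codes => count_new.
have -> : count (fun a => a \notin [seq phi z | z <- codes m]) (codes k) =
          count (predC old) (codes k) by [].
by lia.
Qed.

(** * Proper colorings of signed complete graphs as sequences *)

Lemma big_tuple_cons (R : nmodType) (T : finType) r (G : seq T -> R) :
  \sum_(t : r.+1.-tuple T) G t = \sum_(a : T) \sum_(t : r.-tuple T) G (a :: t).
Proof.
rewrite pair_bigA /= (reindex (fun u : T * r.-tuple T => [tuple of u.1 :: u.2])) //=.
exists (fun t : r.+1.-tuple T => (thead t, [tuple of behead t])) => [[a t] _|t _].
  by rewrite /thead tnth0; congr pair; apply: val_inj.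
by rewrite [RHS]tuple_eta; apply: val_inj.
Qed.

Lemma extensions_sum_tuples k Q r s :
  extensions k Q r s =
  \sum_(t : r.-tuple 'I_(2 * k + 1)) (Q (s ++ [seq color i | i <- t]))%:Z.
Proof.
elim: r s => [|r IHr] s.
  rewrite (big_pred1 [tuple]) ?cats0 // => t.
  by rewrite [t]tuple0; apply/esym/eqP/val_inj.
rewrite (big_tuple_cons r (fun t => (Q (s ++ [seq color i | i <- t]))%:Z)) /=.
rewrite -(perm_big _ (perm_color_codes k)) big_map.
apply: eq_bigr => a _; rewrite IHr; apply: eq_bigr => t _.
by rewrite cat_rcons.
Qed.

Definition listed_nat (M : seq (nat * nat)) (i j : nat) :=
  ((i, j) \in M) || ((j, i) \in M).

Definition proper_seq n (M : seq (nat * nat)) (s : seq int) :=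
  (size s == n) &&
  all (fun i => all (fun j =>
    (i != j) ==> (s`_i != if listed_nat M i j then - s`_j else s`_j))
    (iota 0 n)) (iota 0 n).

(** Properness only tests whether two entries are equal or opposite, which an odd map injective on
    the negation-closed set [codes m] preserves and reflects. *)
Lemma proper_seq_invariant n M : relabeling_invariant (proper_seq n M).
Proof.
move=> phi m p [phiN phi_inj] p_sub; rewrite /proper_seq size_map.
case: eqP => //= sz_p.
apply: eq_in_all => i; rewrite mem_iota add0n => /andP[_ lt_i].
apply: eq_in_all => j; rewrite mem_iota add0n => /andP[_ lt_j].
have pi_m : p`_i \in codes m by apply/p_sub/mem_nth; rewrite sz_p.
have pj_m : p`_j \in codes m by apply/p_sub/mem_nth; rewrite sz_p.
rewrite !(nth_map 0) ?sz_p // -phiN -fun_if; congr (_ ==> ~~ _).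
rewrite (inj_in_eq phi_inj) //; case: ifP => // _.
by rewrite memN_codes.
Qed.

Definition nat_pairs n (N : seq ('I_n * 'I_n)) : seq (nat * nat) :=
  [seq (val e.1, val e.2) | e <- N].

Lemma listed_natE n (N : seq ('I_n * 'I_n)) (i j : 'I_n) :
  listed_nat (nat_pairs N) i j = listed N i j.
Proof.
have inj : injective (fun e : 'I_n * 'I_n => (val e.1, val e.2)).
  by move=> [a b] [c d] /= [/val_inj-> /val_inj->].
rewrite /listed_nat /listed /nat_pairs.
by rewrite (mem_map inj N (i, j)) (mem_map inj N (j, i)).
Qed.

Lemma proper_seqE n (N : seq ('I_n * 'I_n)) k (t : n.-tuple 'I_(2 * k + 1)) :
  proper_seq n (nat_pairs N) [seq color i | i <- t] =
  proper_coloring (signedK N) [ffun i => tnth t i].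
Proof.
have nth_t (i : 'I_n) : [seq color a | a <- t]`_i = color (tnth t i).
  by rewrite (nth_map (tnth t i)) ?size_tuple // -tnth_nth.
rewrite /proper_seq size_map size_tuple eqxx /=; apply/idP/idP.
  move=> /allP H; apply/forallP => i; apply/forallP => j.
  have /allP/(_ (val j)) := H (val i) ltac:(by rewrite mem_iota add0n ltn_ord).
  rewrite mem_iota add0n ltn_ord => /(_ isT).
  rewrite !nth_t listed_natE !ffunE /sigma /= /complete_edge.
  by case: (listed N i j); rewrite ?mulN1r ?mul1r.
move=> /forallP H; apply/allP => i; rewrite mem_iota add0n => /andP[_ lt_i].
apply/allP => j; rewrite mem_iota add0n => /andP[_ lt_j].
have /forallP/(_ (Ordinal lt_j)) := H (Ordinal lt_i).
rewrite !ffunE -!nth_t /sigma /= -listed_natE /= /complete_edge.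
by case: listed_nat; rewrite ?mulN1r ?mul1r.
Qed.

(** The hypothesis on [c] does not involve [k], so one finite computation yields the count for all
    [k]. *)
Lemma chrom_signedK n (N : seq ('I_n * 'I_n)) k c :
    pattern_counts (proper_seq n (nat_pairs N)) n [::] 0 = c ->
  (chrom (signedK N) k)%:Z = eval_counts k%:Z 0 c.
Proof.
(* Start from the empty pattern, with the identity embedding the single label 0. *)
move=> <-; rewrite -(@extensions_pattern_counts _ _ _ id) //.
- rewrite extensions_sum_tuples /= /chrom -sum1_card big_mkcond /=.
  rewrite (reindex (fun t : n.-tuple 'I_(2 * k + 1) => [ffun i => tnth t i])) /=.
    rewrite -natz natr_sum; apply: eq_bigr => t _.
    by rewrite inE proper_seqE; case: proper_coloring.
  exists (fun x : {ffun _} => [tuple x i | i < n]) => [t _|x _].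
    by apply: eq_from_tnth => i; rewrite tnth_mktuple ffunE.
  by apply/ffunP => i; rewrite ffunE tnth_mktuple.
- exact: proper_seq_invariant.
- by split=> // ? ? _ _.
- by move=> z; rewrite map_id !mem_codes; lia.
Qed.

Theorem theorem2 (k : nat) (k_gt0 : (0 < k)%N) :
  let K : int := k%:Z in
  (chrom K3_1 k)%:Z = 8 * K ^+ 3 - 2 * K /\
  (forall u v : 'I_3, u != v -> (chrom (K3_2 u v) k)%:Z = 8 * K ^+ 3) /\
  (chrom K4_1 k)%:Z = 16 * K ^+ 4 - 16 * K ^+ 3 - 4 * K ^+ 2 + 4 * K /\
  (chrom K4_2 k)%:Z = 16 * K ^+ 4 - 16 * K ^+ 3 + 4 * K ^+ 2 /\
  (chrom K4_3 k)%:Z = 16 * K ^+ 4 - 16 * K ^+ 3 + 12 * K ^+ 2 - 2 * K /\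
  (chrom K5_1 k)%:Z =
    32 * K ^+ 5 - 80 * K ^+ 4 + 40 * K ^+ 3 + 20 * K ^+ 2 - 12 * K /\
  (chrom K5_2 k)%:Z =
    32 * K ^+ 5 - 80 * K ^+ 4 + 64 * K ^+ 3 - 16 * K ^+ 2 /\
  (chrom K5_3 k)%:Z =
    32 * K ^+ 5 - 80 * K ^+ 4 + 88 * K ^+ 3 - 48 * K ^+ 2 + 10 * K /\
  (chrom K5_4 k)%:Z =
    32 * K ^+ 5 - 80 * K ^+ 4 + 72 * K ^+ 3 - 28 * K ^+ 2 + 4 * K /\
  (chrom K5_5 k)%:Z =
    32 * K ^+ 5 - 80 * K ^+ 4 + 96 * K ^+ 3 - 56 * K ^+ 2 + 12 * K /\
  (chrom K5_6 k)%:Z =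
    32 * K ^+ 5 - 80 * K ^+ 4 + 80 * K ^+ 3 - 40 * K ^+ 2 + 8 * K /\
  (chrom K5_7 k)%:Z =
    32 * K ^+ 5 - 80 * K ^+ 4 + 120 * K ^+ 3 - 80 * K ^+ 2 + 20 * K.
Proof.
(* The lists give the number of proper patterns by number of absolute values. *)
move=> K {k_gt0}; rewrite {}/K; do 11?split.
- by rewrite (@chrom_signedK _ _ _ [:: 0; 3; 6; 1]%N);
    [rewrite /=; ring | vm_compute].
- move=> u v neq_uv.
  rewrite (@chrom_signedK _ _ _ [:: 0; 4; 6; 1]%N); first by rewrite /=; ring.
  (* Six ordered pairs remain, all with the same counts. Since [nat_pairs] keeps only the values,
     the abstract bound proofs do not block the computation. *)
  by case: u v neq_uv => [[|[|[|u]]] ?] [[|[|[|v]]] ?] // _; vm_compute.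
- by rewrite (@chrom_signedK _ _ _ [:: 0; 0; 15; 10; 1]%N);
    [rewrite /=; ring | vm_compute].
- by rewrite (@chrom_signedK _ _ _ [:: 0; 2; 17; 10; 1]%N);
    [rewrite /=; ring | vm_compute].
- by rewrite (@chrom_signedK _ _ _ [:: 0; 5; 19; 10; 1]%N);
    [rewrite /=; ring | vm_compute].
- by rewrite (@chrom_signedK _ _ _ [:: 0; 0; 15; 45; 15; 1]%N);
    [rewrite /=; ring | vm_compute].
- by rewrite (@chrom_signedK _ _ _ [:: 0; 0; 24; 48; 15; 1]%N);
    [rewrite /=; ring | vm_compute].
- by rewrite (@chrom_signedK _ _ _ [:: 0; 1; 34; 51; 15; 1]%N);
    [rewrite /=; ring | vm_compute].
- by rewrite (@chrom_signedK _ _ _ [:: 0; 0; 27; 49; 15; 1]%N);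
    [rewrite /=; ring | vm_compute].
- by rewrite (@chrom_signedK _ _ _ [:: 0; 2; 38; 52; 15; 1]%N);
    [rewrite /=; ring | vm_compute].
- by rewrite (@chrom_signedK _ _ _ [:: 0; 0; 30; 50; 15; 1]%N);
    [rewrite /=; ring | vm_compute].
- by rewrite (@chrom_signedK _ _ _ [:: 0; 6; 50; 55; 15; 1]%N);
    [rewrite /=; ring | vm_compute].
Qed.
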